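(* Let $n\ge 1$ and let $\mathfrak{S}_n$ be the set of permutations of $[n]=\{1,\dots,n\}$. The two sextuple set-valued statistics $$(\mathrm{Cyc},\ \mathrm{Erec}^{p},\ \mathrm{Erec}^{l},\ \mathrm{Exc}^{p},\ \mathrm{Exc}^{l},\ \mathrm{Rar})\quad\text{and}\quad(\mathrm{Arec}^{p},\ \mathrm{Erec}^{p},\ \mathrm{Erec}^{l},\ \mathrm{Exc}^{p},\ \mathrm{Exc}^{l},\ \mathrm{Rar})$$ are equidistributed on $\mathfrak{S}_n$; that is, for all subsets $A,B,C,D,E,F\subseteq[n]$, $$\#\{\sigma\in\mathfrak{S}_n:\ (\mathrm{Cyc}\,\sigma,\mathrm{Erec}^{p}\sigma,\mathrm{Erec}^{l}\sigma,\mathrm{Exc}^{p}\sigma,\mathrm{Exc}^{l}\sigma,\mathrm{Rar}\,\sigma)=(A,B,C,D,E,F)\}$$ $$=\#\{\sigma\in\mathfrak{S}_n:\ (\mathrm{Arec}^{p}\sigma,\mathrm{Erec}^{p}\sigma,\mathrm{Erec}^{l}\sigma,\mathrm{Exc}^{p}\sigma,\mathrm{Exc}^{l}\sigma,\mathrm{Rar}\,\sigma)=(A,B,C,D,E,F)\}.$$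
   Context: For $\sigma\in\mathfrak{S}_n$ and $i\in[n]$, the pair $(i,\sigma(i))$ is called: a record if $\sigma(j)<\sigma(i)$ for all $j<i$; an antirecord if $\sigma(j)>\sigma(i)$ for all $j>i$; an exclusive record if it is a record but not an antirecord; a record-antirecord if it is both a record and an antirecord; an excedance if $\sigma(i)>i$. The index $i$ is the position and $\sigma(i)$ the letter. Define: $\mathrm{Arec}^{p}\sigma=\{i:(i,\sigma(i))\text{ is an antirecord}\}$; $\mathrm{Erec}^{p}\sigma=\{i:(i,\sigma(i))\text{ is an exclusive record}\}$ and $\mathrm{Erec}^{l}\sigma=\{\sigma(i):(i,\sigma(i))\text{ is an exclusive record}\}$; $\mathrm{Exc}^{p}\sigma=\{i:\sigma(i)>i\}$ and $\mathrm{Exc}^{l}\sigma=\{\sigma(i):\sigma(i)>i\}$; $\mathrm{Rar}\,\sigma=\{i:(i,\sigma(i))\text{ is a record-antirecord}\}$ (for such $i$ one has $\sigma(i)=i$). Finally $\mathrm{Cyc}\,\sigma$ is the set of maximum elements of the cycles in the disjoint cycle decomposition of $\sigma$ (fixed points included as cycles of length one). *)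

(* Defs.v *)
From mathcomp Require Import all_boot all_fingroup.
Set Implicit Arguments.
Unset Strict Implicit.
Unset Printing Implicit Defensive.

(* [n] is represented by 'I_n: the integer k in {1, ..., n} is the ordinal of
   value k.-1, for positions and letters alike. *)

Definition record (n : nat) (s : 'S_n) (i : 'I_n) : bool :=
  [forall j : 'I_n, (j < i) ==> (s j < s i)].

Definition antirecord (n : nat) (s : 'S_n) (i : 'I_n) : bool :=
  [forall j : 'I_n, (i < j) ==> (s i < s j)].

Definition exclusive_record (n : nat) (s : 'S_n) (i : 'I_n) : bool :=
  record s i && ~~ antirecord s i.

Definition record_antirecord (n : nat) (s : 'S_n) (i : 'I_n) : bool :=
  record s i && antirecord s i.

Definition excedance (n : nat) (s : 'S_n) (i : 'I_n) : bool := i < s i.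

Definition Arecp (n : nat) (s : 'S_n) : {set 'I_n} :=
  [set i | antirecord s i].

Definition Erecp (n : nat) (s : 'S_n) : {set 'I_n} :=
  [set i | exclusive_record s i].

Definition Erecl (n : nat) (s : 'S_n) : {set 'I_n} :=
  [set s i | i : 'I_n & exclusive_record s i].

Definition Excp (n : nat) (s : 'S_n) : {set 'I_n} :=
  [set i | excedance s i].

Definition Excl (n : nat) (s : 'S_n) : {set 'I_n} :=
  [set s i | i : 'I_n & excedance s i].

Definition Rar (n : nat) (s : 'S_n) : {set 'I_n} :=
  [set i | record_antirecord s i].

Definition Cyc (n : nat) (s : 'S_n) : {set 'I_n} :=
  [set i : 'I_n | [exists C in porbits s,
                     (i \in C) && [forall j in C, j <= i]]].

(* Main.v *)
(** Split a permutation [s] into its excedances and its weak antiexcedances.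
    Every statistic except [Cyc] and [Arecp] only depends on the excedances
    (with positions and letters), so fix those and choose the images of the other
    positions in increasing order.  When position [k] is reached, the letters
    that are at most [k] and still free number one more than the excedances
    crossing [k], whatever the earlier choices.  Exactly one of them, the smallest
    one, makes [k] an antirecord; exactly one of them closes a cycle at [k], which
    then has maximum [k].  So on each class both sets have the same product-form
    distribution. *)

Require Import Defs.
From mathcomp Require Import all_boot all_fingroup.
From mathcomp Require Import zify.
Set Implicit Arguments.
Unset Strict Implicit.
Unset Printing Implicit Defensive.

(** * The excedance part and the statistics it determines *)

(** The default [i] is never the letter of an excedance at [i], so the excedance positions can still
    be read off. *)
Definition exc_part (n : nat) (s : 'S_n) : {ffun 'I_n -> 'I_n} :=
  [ffun i : 'I_n => if i < s i then s i else i].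

Lemma exc_part_gt (n : nat) (s : 'S_n) (i k : 'I_n) :
  i <= k -> (k < exc_part s i) = (k < s i).
Proof. by rewrite ffunE; case: ifP; lia. Qed.

Lemma exc_part_excedance (n : nat) (s : 'S_n) (i : 'I_n) :
  i < s i -> exc_part s i = s i.
Proof. by rewrite ffunE => ->. Qed.

Lemma exc_part_le (n : nat) (s : 'S_n) (i : 'I_n) :
  s i <= i -> exc_part s i = i.
Proof. by rewrite ffunE ltnNge => ->. Qed.

Lemma excedance_eq (n : nat) (s t : 'S_n) (i : 'I_n) :
  exc_part s = exc_part t -> (i < s i) = (i < t i).
Proof. by move=> e; rewrite -(exc_part_gt s (leqnn i)) e exc_part_gt. Qed.

Lemma card_ord_lt (n k : nat) : k <= n -> #|[set i : 'I_n | i < k]| = k.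
Proof.
move=> le_kn; rewrite -sum1_card -[RHS]card_ord -sum1_card.
rewrite (eq_bigl (fun i : 'I_n => i < k)) => [|i]; last by rewrite inE.
by rewrite -(big_ord_widen n (fun _ => 1) le_kn).
Qed.

(** There are [k + 1] letters at most [k] but only [k] positions below [k]; discard the pairs
    [(j, s j)] meeting both conditions. *)
Lemma card_straddling (n : nat) (s : 'S_n) (k : 'I_n) :
  #|[set j | s j <= k <= j]| = (#|[set j : 'I_n | (j < k) && (k < s j)]|).+1.
Proof.
have h1 : #|[set j | s j < k.+1]| = k.+1.
  rewrite -[RHS](card_ord_lt (ltn_ord k)) -[RHS](card_preimset _ (@perm_inj _ s)).
  by apply: eq_card => j; rewrite !inE.
have h2 := card_ord_lt (ltnW (ltn_ord k)).
have := cardsID [set i : 'I_n | i < k] [set j | s j < k.+1].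
have := cardsID [set j | s j < k.+1] [set i : 'I_n | i < k].
rewrite h1 h2 setIC.
set a := #|_ :&: _|.
have -> : [set i : 'I_n | i < k] :\: [set j | s j < k.+1]
          = [set j : 'I_n | (j < k) && (k < s j)].
  by apply/setP => j; rewrite !inE; lia.
have -> : [set j | s j < k.+1] :\: [set i : 'I_n | i < k] = [set j | s j <= k <= j].
  by apply/setP => j; rewrite !inE; lia.
by move=> d1 d2; apply: (@addnI a); rewrite addnS d1 d2.
Qed.

Lemma straddling_exists (n : nat) (s : 'S_n) (i : 'I_n) :
  i < s i -> exists2 j : 'I_n, s j <= i & i < j.
Proof.
move=> lt_i; have /card_gt0P[j] : 0 < #|[set j | s j <= i <= j]|.
  by rewrite card_straddling.
rewrite inE => /andP[le1 le2]; exists j => //.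
by rewrite ltn_neqAle le2 andbT; apply/eqP => /val_inj eq_ij; subst j; lia.
Qed.

Lemma antirecord_le (n : nat) (s : 'S_n) (i : 'I_n) : antirecord s i -> s i <= i.
Proof.
move=> /forallP anti; rewrite leqNgt; apply/negP => lt_i.
have [j le1 lt2] := straddling_exists lt_i.
by have := anti j; rewrite lt2 /=; lia.
Qed.

(** Either side says that [s] preserves the positions below [i] and fixes [i]: no excedance from
    below reaches [i], and [i] is not one. *)
Lemma record_antirecordE (n : nat) (s : 'S_n) (i : 'I_n) :
  record_antirecord s i =
  [forall j : 'I_n, (j <= i) ==> (exc_part s j <= i)]
    && [forall j : 'I_n, (j < i) ==> (exc_part s j < i)].
Proof.
apply/andP/andP => [[/forallP rec anti] | [/forallP h1 /forallP h2]].
  have le_i := antirecord_le anti.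
  have hj (j : 'I_n) : j < i -> exc_part s j < i.
    by move=> lt_ji; have := rec j; rewrite lt_ji ffunE /=; case: ifP; lia.
  split; apply/forallP => j; apply/implyP; [|exact: hj].
  rewrite leq_eqVlt => /orP[/eqP/val_inj -> | /hj/ltnW //].
  by rewrite (exc_part_le le_i).
have le_i : s i <= i by have := h1 i; rewrite leqnn /= leqNgt exc_part_gt // -leqNgt.
have hlt (j : 'I_n) : j < i -> s j < i.
  by move=> lt_ji; have := h2 j; rewrite lt_ji ffunE /=; case: ifP; lia.
(* A letter at most [i] placed right of [i] would straddle [i] together with [i] itself; by the
   count an excedance would then cross [i], against [hlt]. *)
have hgt (j : 'I_n) : i < j -> i < s j.
  move=> lt_ij; rewrite ltnNge; apply/negP => le_j.
  have : 1 < #|[set j | s j <= i <= j]|.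
    apply/card_gt1P; exists i, j; rewrite !inE le_i le_j leqnn (ltnW lt_ij).
    by split=> //; rewrite -val_eqE neq_ltn lt_ij.
  rewrite card_straddling ltnS => /card_gt0P[l]; rewrite inE => /andP[/hlt]; lia.
have si : s i = i.
  have := permKV s i; move: (s^-1 i)%g => j sj.
  by case: (ltngtP j i) => [/hlt | /hgt | /val_inj ji]; rewrite ?sj ?ltnn // -{1}ji.
split; apply/forallP => j; apply/implyP; rewrite si; [exact: hlt | exact: hgt].
Qed.

(** A record that is no excedance is a record-antirecord. Left of an excedance, non-excedances are
    harmless: both their letter and their default lie below its letter. *)
Lemma exclusive_recordE (n : nat) (s : 'S_n) (i : 'I_n) :
  exclusive_record s i =
  (i < exc_part s i) && [forall j : 'I_n, (j < i) ==> (exc_part s j < exc_part s i)].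
Proof.
rewrite exc_part_gt //.
apply/andP/andP => [[rec nanti] | [lt_i /forallP h]].
  have lt_i : i < s i.
    rewrite ltnNge; apply: contra nanti => le_i.
    have hj (j : 'I_n) : j < i -> exc_part s j < i.
      move=> lt_ji; have /forallP/(_ j) := rec; rewrite lt_ji ffunE /=.
      by case: ifP; lia.
    suff : record_antirecord s i by case/andP.
    rewrite record_antirecordE; apply/andP; split;
      apply/forallP => j; apply/implyP; [|exact: hj].
    rewrite leq_eqVlt => /orP[/eqP/val_inj -> | /hj/ltnW //].
    by rewrite (exc_part_le le_i).
  split=> //; apply/forallP => j; apply/implyP => lt_ji.
  rewrite (exc_part_excedance lt_i) ffunE.
  by have /forallP/(_ j) := rec; rewrite lt_ji /=; case: ifP; lia.
split; last by apply/negP => /antirecord_le; lia.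
apply/forallP => j; apply/implyP => lt_ji.
have := h j; rewrite lt_ji (exc_part_excedance lt_i) ffunE /=.
by case: ifP; lia.
Qed.

Definition exc_stats (n : nat) (s : 'S_n) :=
  (Erecp s, Erecl s, Excp s, Excl s, Rar s).

Lemma exc_stats_eq (n : nat) (s t : 'S_n) :
  exc_part s = exc_part t -> exc_stats s = exc_stats t.
Proof.
move=> e; have exc i : excedance s i = excedance t i.
  exact: excedance_eq.
have erec i : exclusive_record s i = exclusive_record t i.
  by rewrite !exclusive_recordE e.
have val i : excedance s i -> s i = t i.
  by move=> h; rewrite -exc_part_excedance // e exc_part_excedance // -[_ < _]exc.
have erec_exc i : exclusive_record s i -> excedance s i.
  by rewrite exclusive_recordE exc_part_gt // => /andP[].
congr (_, _, _, _, _).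
- by apply/setP => i; rewrite !inE erec.
- rewrite /Erecl; apply/setP => x; apply/imsetP/imsetP => -[i]; rewrite inE => hi ->.
    by exists i; rewrite ?inE -?erec // val // erec_exc.
  by exists i; rewrite ?inE ?erec // val // erec_exc // erec.
- by apply/setP => i; rewrite !inE exc.
- rewrite /Excl; apply/setP => x; apply/imsetP/imsetP => -[i]; rewrite inE => hi ->.
    by exists i; rewrite ?inE -?exc // val.
  by exists i; rewrite ?inE ?exc // val // exc.
- by apply/setP => i; rewrite !inE !record_antirecordE e.
Qed.

(** * Marks that single out one choice at each position *)

(* Among the permutations that extend a given choice below [k], exactly one choice
   at [k] is marked: the third clause gives its existence, the last its
   uniqueness, since [tperm k j * s] ranges over all choices when [j] ranges over
   the positions with [s j <= k <= j]. *)
Definition sequential_mark (n : nat) (M : 'S_n -> pred 'I_n) : Prop :=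
  [/\ forall (s t : 'S_n) (i : 'I_n),
        (forall j : 'I_n, j <= i -> s j = t j) -> M s i = M t i,
      forall (s : 'S_n) (i : 'I_n), M s i -> s i <= i,
      forall (s : 'S_n) (k : 'I_n), s k <= k ->
        exists t : 'S_n, [/\ exc_part t = exc_part s,
                             forall j : 'I_n, j < k -> t j = s j & M t k]
    & forall (s : 'S_n) (k j : 'I_n),
        M s k -> s j <= k < j -> ~~ M (tperm k j * s)%g k].

(** Positions [k] and [j] carry letters at most [k] both before and after the swap, so they are
    never excedances. *)
Lemma exc_part_tperm (n : nat) (s : 'S_n) (k j : 'I_n) :
  s k <= k -> s j <= k <= j -> exc_part (tperm k j * s)%g = exc_part s.
Proof.
move=> le_k /andP[le_j le_kj]; apply/ffunP => i; rewrite !ffunE permM.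
case: tpermP => [-> | -> | //]; do !case: ifP => //; lia.
Qed.

Lemma tperm_agree (n : nat) (s : 'S_n) (k j i : 'I_n) :
  k <= j -> i < k -> (tperm k j * s)%g i = s i.
Proof.
move=> le_kj lt_ik; rewrite permM tpermD //; apply/eqP => eq_i;
  move: lt_ik le_kj; rewrite eq_i; lia.
Qed.

(** * Antirecords *)

Lemma antirecord_sequential (n : nat) : sequential_mark (@antirecord n).
Proof.
have loc (s t : 'S_n) (i : 'I_n) : (forall j : 'I_n, j <= i -> s j = t j) ->
    antirecord s i -> antirecord t i.
  move=> st /forallP h; apply/forallP => j; apply/implyP => lt_ij.
  (* The letter [t j] is pulled back through [s]: a source [l] at most [i] would have to be [j]
     itself. *)
  rewrite -(st i) //; have sl := permKV s (t j); move: (s^-1 (t j))%g sl => l sl.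
  case: (leqP l i) => [le_li | lt_il].
    have eq_lj : l = j by apply: (@perm_inj _ t); rewrite -st.
    by move: le_li; rewrite eq_lj leqNgt lt_ij.
  by have := h l; rewrite lt_il sl.
split.
- by move=> s t i st; apply/idP/idP; apply: loc => // j /st.
- by move=> s i; apply: antirecord_le.
- move=> s k le_k.
  (* The smallest letter found from [k] on is at most [k], because [s k] competes. *)
  have [j le_kj minj] := @arg_minnP _ k (fun j : 'I_n => k <= j) (fun j => s j) (leqnn k).
  have le_j := leq_trans (minj k (leqnn k)) le_k.
  exists (tperm k j * s)%g; split.
  + by apply: exc_part_tperm; rewrite ?le_j.
  + by move=> i; apply: tperm_agree.
  + apply/forallP => l; apply/implyP => lt_kl; rewrite !permM tpermL.
    have neq : s j != s (tperm k j l).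
      by rewrite (inj_eq perm_inj) -[X in X == _](tpermL k j)
        (inj_eq perm_inj) neq_ltn lt_kl.
    rewrite ltn_neqAle; apply/andP; split=> //; apply: minj.
    by case: tpermP => [_ | _ | _ _]; [exact: le_kj | exact: leqnn | exact: ltnW].
- move=> s k j /forallP h /andP[le_j lt_kj]; apply/forallPn; exists j.
  by have := h j; rewrite lt_kj !permM tpermL tpermR /=; lia.
Qed.

(** * Cycle maxima *)

Lemma mem_Cyc (n : nat) (s : 'S_n) (i : 'I_n) :
  (i \in Cyc s) = [forall j in porbit s i, j <= i].
Proof.
rewrite inE; apply/existsP/idP => [[C /and3P[/imsetP[x _ ->] ix]] | h].
  by move: ix; rewrite -eq_porbit_mem => /eqP ->.
by exists (porbit s i); rewrite h porbit_id imset_f.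
Qed.

Lemma Cyc_sequential (n : nat) : sequential_mark (fun s (i : 'I_n) => i \in Cyc s).
Proof.
(* A cycle with maximum [i] only visits positions at most [i], where [s] and [t] agree. *)
have loc (s t : 'S_n) (i : 'I_n) : (forall j : 'I_n, j <= i -> s j = t j) ->
    i \in Cyc s -> i \in Cyc t.
  move=> st; rewrite !mem_Cyc => /forall_inP h.
  apply/forall_inP => _ /porbitP[m ->].
  suff -> : ((t ^+ m) i = (s ^+ m) i)%g by apply: h; apply: mem_porbit.
  elim: m => [|m IHm]; first by rewrite !expg0.
  by rewrite !expgSr !permM IHm st // h // mem_porbit.
(* For distinct [k] and [j], the swap changes the number of cycles by one. Counting from [s] and
   back from the product, exactly one of the two has [k] and [j] in a common cycle. *)
have merge (s : 'S_n) (k j : 'I_n) : (k \in porbit (tperm k j * s)%g j) =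
    (k == j) || (k \notin porbit s j).
  have [-> | neq] := eqVneq k j; first by rewrite porbit_id.
  have := porbits_mul_tperm s k j.
  have := porbits_mul_tperm (tperm k j * s)%g k j.
  rewrite /= mulgA tperm2 mul1g neq /=.
  move: #|porbits s| #|porbits (_ * s)| => p q.
  by case: (k \in porbit s j); case: (k \in porbit _ j) => //=; lia.
split.
- by move=> s t i st; apply/idP/idP; apply: loc => // j /st.
- move=> s i; rewrite mem_Cyc => /forall_inP; apply.
  by have := mem_porbit s 1 i; rewrite expg1.
- move=> s k le_k.
  (* With the most cycles among the extensions, [k] is the maximum of its cycle:
     otherwise that cycle could be split at a step down from above [k]. *)
  pose P (t : 'S_n) :=
    (exc_part t == exc_part s) && [forall j : 'I_n, (j < k) ==> (t j == s j)].
  have Ps : P s by rewrite /P eqxx; apply/forallP => j; rewrite eqxx implybT.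
  have [t Pt maxt] := arg_maxnP (fun t : 'S_n => #|porbits t|) Ps.
  have /andP[/eqP et /forallP agt] := Pt.
  have le_tk : t k <= k by rewrite leqNgt (excedance_eq k et) -leqNgt.
  exists t; split=> // [j lt_jk|]; first by have := agt j; rewrite lt_jk => /eqP.
  rewrite mem_Cyc; apply/forall_inP => x kx; rewrite leqNgt; apply/negP => lt_kx.
  have [j [jk lt_kj le_j]] : exists j : 'I_n, [/\ j \in porbit t k, k < j & t j <= k].
    case: (pickP (fun j : 'I_n => [&& j \in porbit t k, k < j & t j <= k]))
      => [j /and3P[]|none].
      by exists j.
    (* Without a step down, the orbit of [x] would stay above [k] and never return to [k]. *)
    have up m : k < (t ^+ m)%g x.
      elim: m => [|m IHm]; first by rewrite expg0 perm1.
      have := none ((t ^+ m)%g x); rewrite IHm expgSr permM.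
      have -> : (t ^+ m)%g x \in porbit t k.
        by move: kx; rewrite -eq_porbit_mem => /eqP <-; apply: mem_porbit.
      by rewrite /= => /negbT; rewrite -ltnNge.
    move: kx; rewrite porbit_sym => /porbitP[m km].
    by have := up m; rewrite -km ltnn.
  have Pt' : P (tperm k j * t)%g.
    have ht : t j <= k <= j by rewrite le_j ltnW.
    rewrite /P (exc_part_tperm le_tk ht) et eqxx /=.
    apply/forallP => i; apply/implyP => lt_ik.
    by rewrite (tperm_agree t (ltnW lt_kj) lt_ik); have := agt i; rewrite lt_ik.
  have := maxt _ Pt'; have := porbits_mul_tperm t k j.
  rewrite porbit_sym jk (_ : k != j) /= ?neq_ltn ?lt_kj // addn0 => ->.
  by rewrite /geq /= addn1 ltnn.
- move=> s k j; rewrite !mem_Cyc => /forall_inP h /andP[le_j lt_kj].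
  (* Since [j] exceeds the maximum [k], it lies in another cycle; the swap merges the two and [k] is
     no longer the maximum. *)
  have nj : k \notin porbit s j.
    by rewrite porbit_sym; apply/negP => /h; rewrite leqNgt lt_kj.
  apply/forall_inPn; exists j; last by rewrite -ltnNge.
  by rewrite porbit_sym merge nj orbT.
Qed.

(** * Counting by successive choices *)

(** Number of images at [i] with the mark prescribed by [A]: an excedance has a forced, unmarked
    image; any other position has one marked choice and as many unmarked ones as excedances crossing
    it. *)
Definition weight (n : nat) (e : {ffun 'I_n -> 'I_n}) (A : {set 'I_n}) (i : 'I_n) : nat :=
  if i < e i then nat_of_bool (i \notin A) else
  if i \in A then 1 else #|[set j : 'I_n | (j < i) && (i < e j)]|.

Definition completions (n : nat) (M : 'S_n -> pred 'I_n) (A : {set 'I_n})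
    (s : 'S_n) (k : nat) : {set 'S_n} :=
  [set t | [&& exc_part t == exc_part s,
               [forall i : 'I_n, (i < k) ==> (t i == s i)]
             & [forall i : 'I_n, (k <= i) ==> (M t i == (i \in A))]]].

Lemma completionsP (n : nat) (M : 'S_n -> pred 'I_n) (A : {set 'I_n})
    (s t : 'S_n) (k : nat) :
  reflect [/\ exc_part t = exc_part s,
              forall i : 'I_n, i < k -> t i = s i
            & forall i : 'I_n, k <= i -> M t i = (i \in A)]
          (t \in completions M A s k).
Proof.
rewrite inE; apply: (iffP and3P) => -[h1 h2 h3]; split.
- exact/eqP.
- by move=> i lt_i; have /forallP/(_ i) := h2; rewrite lt_i => /eqP.
- by move=> i lt_i; have /forallP/(_ i) := h3; rewrite lt_i => /eqP.
- exact/eqP.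
- by apply/forallP => i; apply/implyP => /h2 ->.
- by apply/forallP => i; apply/implyP => /h3 ->.
Qed.

(** Images are chosen one position at a time from [k] on; each factor depends on the excedances and
    [A] alone, hence neither on [M] nor on earlier choices. *)
Lemma card_completions (n : nat) (M : 'S_n -> pred 'I_n) (A : {set 'I_n})
    (s : 'S_n) (k : nat) :
  sequential_mark M -> k <= n ->
  #|completions M A s k| = \prod_(i < n | k <= i) weight (exc_part s) A i.
Proof.
move=> [loc le base uniq] le_kn; move: {2}(n - k) (erefl (n - k)) => d.
elim: d k s le_kn => [|d IHd] k s le_kn dE.
  rewrite big_pred0 => [|i]; last by have := ltn_ord i; lia.
  rewrite (_ : completions _ _ _ _ = [set s]) ?cards1 //.
  apply/setP => t; rewrite in_set1.
  apply/completionsP/eqP => [[_ ag _] | ->].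
    by apply/permP => i; apply: ag; have := ltn_ord i; lia.
  by split=> // i; have := ltn_ord i; lia.
have lt_kn : k < n by lia.
pose x := Ordinal lt_kn.
have splitw : \prod_(i < n | k <= i) weight (exc_part s) A i =
    weight (exc_part s) A x * \prod_(i < n | k.+1 <= i) weight (exc_part s) A i.
  rewrite (bigD1 x) //=; congr (_ * _); apply: eq_bigl => i.
  by rewrite -val_eqE /=; lia.
rewrite {}splitw.
(* Fixing the image of [x] as [s' x] decides the mark at [x]: either it is wrong and nothing
   remains, or the count goes on from [k.+1]. *)
have restrict (s' : 'S_n) (Q : pred 'S_n) : exc_part s' = exc_part s ->
    (forall i : 'I_n, i < k -> s' i = s i) ->
    (forall t, Q t = (t x == s' x)) ->
    #|[set t in completions M A s k | Q t]| =
    (M s' x == (x \in A)) * \prod_(i < n | k.+1 <= i) weight (exc_part s) A i.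
  move=> es' ags' QE.
  have step : [set t in completions M A s k | Q t] =
      if M s' x == (x \in A) then completions M A s' k.+1 else set0.
    apply/setP => t; rewrite in_set QE.
    case: ifP => [/eqP Mx | Mx].
      apply/andP/completionsP => [[/completionsP[h1 h2 h3] /eqP h4] | [h1 h2 h3]].
        split=> [|i|i lt_ki]; [by rewrite h1 | | by apply: h3; lia].
        rewrite ltnS leq_eqVlt => /orP[/eqP ik | lt_ik]; last by rewrite h2 ?ags'.
        by rewrite (_ : i = x) //; apply: val_inj.
      split; last by rewrite h2.
      apply/completionsP; split=> [|i lt_ik|i]; first by rewrite h1.
        by rewrite h2 ?ags' //; lia.
      rewrite leq_eqVlt => /orP[/eqP ik | ]; last exact: h3.
      have -> : i = x by apply: val_inj.
      by rewrite -Mx; apply: loc => j le_j; apply: h2.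
    rewrite in_set0; apply/negP => /andP[/completionsP[h1 h2 h3] /eqP h4].
    move/negP: Mx; apply; apply/eqP; rewrite -h3 //; apply: loc => j le_j.
    case: (ltnP j k) => [lt_jk | le_kj]; first by rewrite h2 ?ags'.
    by rewrite (_ : j = x) //; apply: val_inj => /=; move: le_j => /=; lia.
  rewrite step; case: ifP => _; last by rewrite cards0.
  by rewrite mul1n IHd ?es' //; lia.
have exc_le (t : 'S_n) : exc_part t = exc_part s -> (t x <= x) = (s x <= x).
  by move=> et; rewrite leqNgt (excedance_eq x et) -leqNgt.
rewrite {1}/weight exc_part_gt //; case: (ltnP x (s x)) => [lt_x | le_x].
  have Mx : M s x = false by apply/negP => /le; rewrite leqNgt lt_x.
  rewrite -[x \notin A]eqbF_neg eq_sym -Mx.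
  rewrite -(restrict s (fun t => t x == s x)) //.
  apply: eq_card => t; rewrite inE andbC; case: completionsP; rewrite ?andbF //.
  move=> [et _ _].
  have lt_tx : x < t x by rewrite ltnNge exc_le // -ltnNge.
  by rewrite -(exc_part_excedance lt_tx) et exc_part_excedance // eqxx.
(* The marked extension [r] serves as reference: every choice at [x] is a letter [r j] with [j] in
   [J], and only [j = x] gives a mark. *)
have [r [er agr Mr]] := base s x le_x.
have le_rx : r x <= x by rewrite exc_le.
pose J := [set j | r j <= x <= j].
have xJ : x \in J by rewrite inE le_rx leqnn.
have MJ j : j \in J -> M (tperm x j * r)%g x = (j == x).
  rewrite inE => /andP[le_j le_xj].
  have [-> | neq] := eqVneq j x; first by rewrite tperm1 mul1g.
  apply/negbTE/uniq => //; rewrite le_j ltn_neqAle le_xj andbT.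
  by rewrite eq_sym.
have cardJ : #|J| = (#|[set j : 'I_n | (j < x) && (x < exc_part s j)]|).+1.
  rewrite card_straddling; congr _.+1; apply: eq_card => j; rewrite !inE.
  by case: (ltnP j x) => // lt_jx; rewrite -er exc_part_gt // ltnW.
(* Sort by the position in [r] of the letter chosen at [x]; a position below [x] is impossible since
   [t] and [r] agree there. *)
rewrite -sum1_card (partition_big (fun t : 'S_n => (r^-1)%g (t x)) (mem J)) /=; last first.
  move=> t /completionsP[et agt _].
  rewrite inE permKV exc_le // le_x /= leqNgt; apply/negP => lt_x.
  have := agt _ lt_x; rewrite -agr // permKV => /perm_inj eq_x.
  by move: lt_x; rewrite eq_x ltnn.
transitivity (\sum_(j in J) ((j == x) == (x \in A)) *
                 \prod_(i < n | k.+1 <= i) weight (exc_part s) A i).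
  apply: eq_bigr => j jJ; rewrite sum1dep_card -(MJ j jJ).
  move: jJ; rewrite inE => /andP[le_j le_xj].
  rewrite -(restrict _ (fun t => (r^-1)%g (t x) == j)) //.
  - by rewrite exc_part_tperm ?le_j.
  - by move=> i lt_ik; rewrite tperm_agree // agr.
  - by move=> t; rewrite permM tpermL (canF_eq (permKV r)).
rewrite -big_distrl /=; congr (_ * _).
rewrite (bigD1 x) //= eqxx; case: (x \in A) => /=.
  by rewrite big1 // => j /andP[_ /negbTE ->].
rewrite (eq_bigr (fun=> 1)) => [|j /andP[_ /negbTE -> //]].
rewrite add0n sum1dep_card; apply: succn_inj; rewrite -cardJ (cardsD1 x J) xJ add1n.
by congr _.+1; apply: eq_card => j; rewrite !inE andbC.
Qed.

(** * Equidistribution *)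

(** [Q] is constant on each class of equal excedance part, so a class contributes nothing, or the
    same product of weights for both marks. *)
Lemma sequential_mark_equidistribution (n : nat) (M N : 'S_n -> pred 'I_n)
    (Q : pred 'S_n) (A : {set 'I_n}) :
  sequential_mark M -> sequential_mark N ->
  (forall s t : 'S_n, exc_part s = exc_part t -> Q s = Q t) ->
  #|[set s | ([set i | M s i] == A) && Q s]| = #|[set s | ([set i | N s i] == A) && Q s]|.
Proof.
move=> markM markN QE.
rewrite -!sum1dep_card !(partition_big (@exc_part n) predT) //=.
apply: eq_bigr => e _; rewrite !sum1dep_card.
have class (L : 'S_n -> pred 'I_n) (r : 'S_n) : exc_part r = e -> Q r ->
    [set s | (([set i | L s i] == A) && Q s) && (exc_part s == e)] = completions L A r 0.
  move=> er Qr; apply/setP => s; rewrite inE.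
  apply/andP/completionsP => [[/andP[/eqP LA _] /eqP es] | [es _ LA]].
    by split=> [|//|i _]; rewrite ?es // -LA inE.
  rewrite es er eqxx (QE s r es) Qr andbT; split=> //.
  by apply/eqP/setP => i; rewrite inE LA.
case: (pickP (fun r : 'S_n => (exc_part r == e) && Q r)) => [r /andP[/eqP er Qr] | none].
  by rewrite !(class _ r) // !card_completions.
by apply: eq_card => s; have := none s; rewrite !inE;
  case: eqP => _ /= => [-> | _]; rewrite ?andbF.
Qed.

Theorem theorem1 (n : nat) (n_ge1 : 1 <= n) (A B C D E F : {set 'I_n}) :
  #|[set s : 'S_n | (Cyc s, Erecp s, Erecl s, Excp s, Excl s, Rar s)
                      == (A, B, C, D, E, F)]|
  = #|[set s : 'S_n | (Arecp s, Erecp s, Erecl s, Excp s, Excl s, Rar s)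
                      == (A, B, C, D, E, F)]|.
Proof.
pose Q (s : 'S_n) := exc_stats s == (B, C, D, E, F).
have QE (s t : 'S_n) : exc_part s = exc_part t -> Q s = Q t.
  by rewrite /Q => /exc_stats_eq ->.
have split_stats (X : {set 'I_n}) s :
    ((X, Erecp s, Erecl s, Excp s, Excl s, Rar s) == (A, B, C, D, E, F))
    = (X == A) && Q s.
  by rewrite /Q /exc_stats !xpair_eqE -!andbA.
have equi := sequential_mark_equidistribution A (@Cyc_sequential n)
  (@antirecord_sequential n) QE.
transitivity #|[set s | ([set i | i \in Cyc s] == A) && Q s]|.
  apply: eq_card => s; rewrite !in_set split_stats.
  by congr ((_ == _) && _); apply/setP => i; rewrite in_set.
by rewrite equi; apply: eq_card => s; rewrite !in_set split_stats.
Qed.
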